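(* Let $S$ be a semiring and $*: S \to S$, $s\mapsto s^*$, a pc-function. Let $P$ be a prime ideal of $S$ with the property that, for every $s \in S$, $s\in P$ implies $s^* \notin P$. Then the following statements hold: (1) If $s\in P$, then $s^{**} \in P$. (2) $P$ is a minimal prime ideal of $S$.
   Context: A semiring is a set $S$ with operations $+,\cdot$ such that $(S,+)$ is a commutative monoid with identity $0$, $(S,\cdot)$ is a commutative monoid with identity $1\neq 0$, multiplication distributes over addition, and $s\cdot 0=0$ for all $s\in S$. A nonempty subset $I\subseteq S$ is an ideal if $a+b\in I$ and $sa\in I$ for all $a,b\in I$, $s\in S$. An ideal $P\neq S$ is prime if $ab\in P$ implies $a\in P$ or $b\in P$. A minimal prime ideal of $S$ is a prime ideal that is minimal with respect to inclusion among all prime ideals of $S$. A function $*:S\to S$, written $s\mapsto s^*$, is a pc-function (pseudocomplemented function) if $s\cdot s^*=0$ for all $s\in S$. Write $s^{**}=(s^* )^*$. *)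

(* Defs.v *)
From mathcomp Require Import all_boot all_order all_algebra.
From mathcomp Require Import all_classical.

Set Implicit Arguments.
Unset Strict Implicit.
Unset Printing Implicit Defensive.

Import GRing.Theory.

Local Open Scope classical_set_scope.
Local Open Scope ring_scope.

(* Semirings are commutative with 1 != 0, i.e. comNzSemiRingType.  The ideal
   theory of ring_quotient is only available over rings and for decidable
   predicates, hence the definitions below, on arbitrary subsets. *)

Definition is_ideal (S : comNzSemiRingType) (I : set S) : Prop :=
  [/\ I !=set0,
      (forall a b : S, I a -> I b -> I (a + b))
    & (forall s a : S, I a -> I (s * a))].

Definition is_prime_ideal (S : comNzSemiRingType) (P : set S) : Prop :=
  [/\ is_ideal P,
      P <> setT
    & (forall a b : S, P (a * b) -> P a \/ P b)].

Definition is_minimal_prime_ideal (S : comNzSemiRingType) (P : set S) : Prop :=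
  is_prime_ideal P /\
  (forall Q : set S, is_prime_ideal Q -> Q `<=` P -> Q = P).

Definition pc_function (S : comNzSemiRingType) (star : S -> S) : Prop :=
  forall s : S, s * star s = 0.

(* Main.v *)
Require Import Defs.
From mathcomp Require Import all_boot all_order all_algebra.
From mathcomp Require Import all_classical.

(** Every ideal contains 0, so a prime ideal contains a factor of each vanishing product
    [t * star t]. For [s] in [P], [P_star] keeps [star s] out of [P], which decides which factor it
    is: take [t = star s] in [P] for (1), and [t = s] in a smaller prime [Q] for (2). *)

Lemma ideal0 (S : comNzSemiRingType) (I : set S) : is_ideal I -> I 0%R.
Proof. by case=> -[a Ia] _ /(_ 0%R a Ia); rewrite GRing.mul0r. Qed.

Theorem theorem2p7 (S : comNzSemiRingType) (star : S -> S) (P : set S)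
    (star_pc : pc_function star) (P_prime : is_prime_ideal P)
    (P_star : forall s : S, P s -> ~ P (star s)) :
  (forall s : S, P s -> P (star (star s))) /\ is_minimal_prime_ideal P.
Proof.
have [idealP _ primeP] := P_prime.
split=> [s Ps|].
  have : P (star s * star (star s))%R by rewrite star_pc; exact: ideal0.
  by case/primeP => // /(P_star s Ps).
split=> // Q [idealQ _ primeQ] QP; apply/seteqP; split=> // s Ps.
(* Primality of [Q], not of [P], is used here: [star s] in [Q] would lie in [P] by [QP]. *)
have : Q (s * star s)%R by rewrite star_pc; exact: ideal0.
by case/primeQ => // /QP /(P_star s Ps).
Qed.
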